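(* Let $n\ge 2$ and $k\ge 2$ be integers, where $k$ is even, and let $P_k$ denote the path with $k$ edges. If $n>\frac{k-2}{2}\left(\frac k2-\left\lfloor\frac{k-2}{4}\right\rfloor\right)$, then $$\mathrm{bbal}(n,P_k)=\mathrm{bbal}(n,P_{k+1})=\left\lfloor\frac{k-2}{4}\right\rfloor n+0^{\alpha},$$ where $\alpha\in\{0,2\}$ is such that $k\equiv\alpha\pmod 4$ (with $0^0=1$ and $0^2=0$). Moreover, if $s=\left\lfloor\frac{k-2}{4}\right\rfloor$, then $\mathrm{Bbal}(n,P_k)=\mathrm{Bbal}(n,P_{k+1})=\{K_{s,n}\}$ if $k\equiv 2\pmod 4$, and $\mathrm{Bbal}(n,P_k)=\mathrm{Bbal}(n,P_{k+1})=\{H_{s,n}\}$ if $k\equiv 0\pmod 4$, where $H_{s,n}$ is the graph $K_{s,n}$ with one extra pendant vertex adjacent to a vertex of the partite set with $n$ vertices.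
   Context: A $2$-edge coloring of $K_{n,n}$ is a partition $E(K_{n,n})=R\sqcup B$ into red edges $R$ and blue edges $B$. A balanced copy of a graph $G$ in such a coloring is a (not necessarily induced) subgraph of $K_{n,n}$ isomorphic to $G$ whose numbers of red and blue edges differ by at most $1$. For a bipartite graph $G$, the bipartite balancing number $\mathrm{bbal}(n,G)$ is the smallest integer $k$ with $0\le k<\lfloor n^2/2\rfloor$ (if it exists) such that every $2$-edge coloring $E(K_{n,n})=R\sqcup B$ with $|R|>k$ and $|B|>k$ contains a balanced copy of $G$. $\mathrm{Bbal}(n,G)$ is the family of graphs with exactly $\mathrm{bbal}(n,G)$ edges such that a $2$-edge coloring $E(K_{n,n})=R\sqcup B$ with at least $\mathrm{bbal}(n,G)$ edges in each color and exactly $\mathrm{bbal}(n,G)$ edges in one color contains no balanced copy of $G$ if and only if the graph induced by the red edges or the graph induced by the blue edges is isomorphic to some $H\in\mathrm{Bbal}(n,G)$. Here graphs are considered up to isomorphism and up to isolated vertices; in particular $K_{0,n}$ is the edgeless graph and $H_{0,n}$ is a single edge. *)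

(* Defs.v *)
From mathcomp Require Import all_boot.

Set Implicit Arguments.
Unset Strict Implicit.
Unset Printing Implicit Defensive.

Record sgraph := SGraph {
  vertex :> finType;
  adj : rel vertex;
  adj_sym : symmetric adj;
  adj_irr : irreflexive adj }.

Definition edge_set (G : sgraph) : {set {set G}} :=
  [set [set p.1; p.2] | p : G * G & adj p.1 p.2].

Definition num_edges (G : sgraph) : nat := #|edge_set G|.

Definition isomorphic (G H : sgraph) : Prop :=
  exists2 f : G -> H, bijective f & forall x y, adj (f x) (f y) = adj x y.

Section Core.
Variable G : sgraph.

Definition core_vertex : finType := {x : G | [exists y, adj x y]}.

Definition core_adj : rel core_vertex := fun x y => adj (val x) (val y).

Fact core_adj_sym : symmetric core_adj.
Proof. by move=> x y; apply: adj_sym. Qed.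

Fact core_adj_irr : irreflexive core_adj.
Proof. by move=> x; apply: adj_irr. Qed.

(* [G] with its isolated vertices deleted. *)
Definition core : sgraph := SGraph core_adj_sym core_adj_irr.

End Core.

(* Isomorphism up to isolated vertices. *)
Definition iso0 (G H : sgraph) : Prop := isomorphic (core G) (core H).

Section BipartiteGraph.
Variables (m n : nat) (E : {set 'I_m * 'I_n}).

Definition bip_adj (x y : 'I_m + 'I_n) : bool :=
  match x, y with
  | inl i, inr j | inr j, inl i => (i, j) \in E
  | _, _ => false
  end.

Fact bip_adj_sym : symmetric bip_adj.
Proof. by case=> i [] j. Qed.

Fact bip_adj_irr : irreflexive bip_adj.
Proof. by case. Qed.

(* The edge {inl i, inr j} is encoded by the pair (i, j). *)
Definition bip_graph : sgraph := SGraph bip_adj_sym bip_adj_irr.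

End BipartiteGraph.

Definition complete_bip (m n : nat) : sgraph :=
  bip_graph [set: 'I_m * 'I_n].

(* The left vertices of index < s form, with the right side, a K_{s,n}; the
   extra left vertex, of index s, is pendant at the right vertex 0. *)
Definition complete_bip_pendant (s n : nat) : sgraph :=
  bip_graph [set e : 'I_s.+1 * 'I_n |
    (e.1 < s) || ((e.1 == s :> nat) && (e.2 == 0 :> nat))].

Section PathGraph.
Variable k : nat.

Definition path_adj : rel 'I_k.+1 := fun i j => (i.+1 == j) || (j.+1 == i).

Fact path_adj_sym : symmetric path_adj.
Proof. by move=> i j; rewrite /path_adj orbC. Qed.

Fact path_adj_irr : irreflexive path_adj.
Proof. by move=> i; rewrite /path_adj orbb eqn_leq ltnn. Qed.

(* The path with k edges, hence k.+1 vertices. *)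
Definition path_graph : sgraph := SGraph path_adj_sym path_adj_irr.

End PathGraph.

(* A 2-edge coloring of K_{n,n} is given by its set R : {set 'I_n * 'I_n} of
   red edges, the set of blue edges being ~: R. *)
Section Balancing.
Variable n : nat.

(* The (not necessarily induced) subgraphs of K_{n,n} isomorphic to G are the
   images of G under such maps. *)
Definition embedding (G : sgraph) (f : G -> complete_bip n n) : Prop :=
  injective f /\ forall u v, adj u v -> adj (f u) (f v).

Definition copy_edges (G : sgraph) (f : G -> complete_bip n n) :
    {set 'I_n * 'I_n} :=
  [set e | [exists u, exists v,
    [&& adj u v, f u == inl e.1 & f v == inr e.2]]].

Definition has_balanced_copy (G : sgraph) (R : {set 'I_n * 'I_n}) : Prop :=
  exists f : G -> complete_bip n n,
    [/\ embedding f,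
        #|copy_edges f :&: R| <= #|copy_edges f :&: ~: R| + 1 &
        #|copy_edges f :&: ~: R| <= #|copy_edges f :&: R| + 1].

Definition forces_balanced (G : sgraph) (k : nat) : Prop :=
  forall R : {set 'I_n * 'I_n},
    k < #|R| -> k < #|~: R| -> has_balanced_copy G R.

(* bbal(n, G) exists and equals b. *)
Definition is_bbal (G : sgraph) (b : nat) : Prop :=
  [/\ b < (n ^ 2) %/ 2, forces_balanced G b &
      forall k, k < (n ^ 2) %/ 2 -> forces_balanced G k -> b <= k].

(* Bbal(n, G) exists and equals F. Families are closed under isomorphism up to
   isolated vertices, and contain only graphs that occur in K_{n,n}: other
   graphs play no role in the defining equivalence. *)
Definition is_Bbal (G : sgraph) (F : sgraph -> Prop) : Prop :=
  exists2 b, is_bbal G b &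
  [/\ forall H H', iso0 H H' -> F H -> F H',
      forall H, F H -> num_edges H = b,
      forall H, F H -> exists E : {set 'I_n * 'I_n}, iso0 (bip_graph E) H &
      forall R : {set 'I_n * 'I_n},
        b <= #|R| -> b <= #|~: R| -> #|R| = b \/ #|~: R| = b ->
        ~ has_balanced_copy G R <->
        exists2 H, F H & iso0 (bip_graph R) H \/ iso0 (bip_graph (~: R)) H].

(* Bbal(n, G) = {H}, as classes of graphs up to isomorphism and isolated
   vertices: the family of graphs equivalent to H is a solution of the
   definition of Bbal(n, G), and the only one. *)
Definition Bbal_is_singleton (G H : sgraph) : Prop :=
  forall F : sgraph -> Prop,
    is_Bbal G F <-> (forall H', F H' <-> iso0 H' H).

End Balancing.

(* Main.v *)
Require Import Defs.
From mathcomp Require Import all_boot zify fingroup perm.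

Set Implicit Arguments.
Unset Strict Implicit.
Unset Printing Implicit Defensive.

(* Write k = 2h, h = 2s + 1 + eps with eps <= 1, and b = sn + eps.  A vertex
   set of size s meets at most 2s edges of a path, so K_{s,n}, with eps extra
   edges, has at most h - 1 edges on any path, which excludes balanced copies
   of P_{2h} and P_{2h+1}.

   Conversely, suppose that there is no balanced copy.  Closing a P_{2h+1} to a
   cycle and rotating it shows that a balanced P_{2h+1} yields a balanced
   P_{2h}.  Exchanging consecutive vertices on one side of a P_{2h+1} changes
   its number of red edges by at most 2, so no exchange can jump over both
   values h and h + 1: after interchanging the colors, every P_{2h+1} has less
   than h red edges.  Then red has no matching of size h, hence by Konig's
   theorem a vertex cover of size less than h; as there are at least b red edges
   and n > (h - 1)(h - s), at least s vertices of the cover have red degree at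
   least h.  If more than eps red edges avoid s such vertices, these edges and
   disjoint two-edge stars at the s vertices can be joined into a P_{2h+1} with h
   red edges.  Otherwise counting forces equality everywhere: the s vertices lie
   on one side and are joined to the whole other side. *)

(** * Konig's theorem *)

Section Konig.
Variables S T : finType.
Implicit Types (E M : {set S * T}) (A : {set S}) (B : {set T}).

Definition matching M :=
  {in M &, injective (@fst S T)} /\ {in M &, injective (@snd S T)}.

Definition covers E A B := [forall e in E, (e.1 \in A) || (e.2 \in B)].

(* If an edge cannot be removed without lowering the cover number, its removal
   leaves a cover with fewer than [t] vertices; uncrossing the two covers
   obtained from two edges with a common end gives a cover of [E] that is too
   small. *)
Lemma konig E t :
    (forall A B, covers E A B -> t <= #|A| + #|B|) ->
  exists M, [/\ M \subset E, matching M & t <= #|M|].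
Proof.
have [m] := ubnP #|E|; elim: m => // m IHm in E * => leEm minE.
have step e : e \in E ->
    (exists M, [/\ M \subset E, matching M & t <= #|M|]) \/
    exists A B, [/\ covers (E :\ e) A B, #|A| + #|B| < t,
                    e.1 \notin A & e.2 \notin B].
  move=> eE; have ltEe : #|E :\ e| < m by have := cardsD1 e E; rewrite eE; lia.
  case: (boolP [exists A, exists B, covers (E :\ e) A B && (#|A| + #|B| < t)]).
    case/existsP=> A /existsP[B /andP[cAB ltABt]]; right; exists A, B.
    have ncAB : ~~ covers E A B by apply: contraL ltABt => /minE; rewrite -leqNgt.
    suff: ~~ ((e.1 \in A) || (e.2 \in B)) by rewrite negb_or => /andP[].
    apply: contra ncAB => eAB; apply/forall_inP => f fE.
    have [-> //|nfe] := eqVneq f e.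
    by apply: (forall_inP cAB); rewrite !inE nfe.
  move=> nAB; left; have [||M [sME mM leM]] := IHm (E :\ e) => //.
    move=> A B cAB; rewrite leqNgt; apply: contra nAB => ltAB.
    by apply/existsP; exists A; apply/existsP; exists B; rewrite cAB.
  by exists M; split=> //; apply: subset_trans sME (subD1set _ _).
case: (boolP (dinjectiveb (@fst S T) (mem E))) => [/dinjectiveP inj1|]; last first.
  case/dinjectivePn=> e eE [f]; rewrite inE => /andP[nfe fE] eq1.
  have [//|[A [B [cAB ltAB e1A e2B]]]] := step e eE.
  have [//|[A' [B' [cAB' ltAB' f1A f2B]]]] := step f fE.
  have := cardsUI A A'; have := cardsUI B B'.
  have: covers E (A :&: A') (B :|: B').
    apply/forall_inP => g gE; rewrite !inE.
    have [->|nge] := eqVneq g e.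
      have := forall_inP cAB' e; rewrite !inE eE eq1 eq_sym nfe (negPf f1A) /=.
      by move=> -> //; rewrite ?orbT.
    have [->|ngf] := eqVneq g f.
      have := forall_inP cAB f; rewrite !inE fE nfe -eq1 (negPf e1A) /=.
      by move=> -> //; rewrite ?orbT.
    have := forall_inP cAB g; have := forall_inP cAB' g.
    rewrite !inE gE nge ngf => /(_ isT)/orP[]-> /(_ isT)/orP[]->;
      by rewrite ?orbT.
  have: covers E (f.1 |: (A :|: A')) (B :&: B').
    apply/forall_inP => g gE; rewrite !inE.
    have [->|nge] := eqVneq g e; first by rewrite eq1 eqxx.
    have [->|ngf] := eqVneq g f; first by rewrite eqxx.
    have := forall_inP cAB g; have := forall_inP cAB' g.
    rewrite !inE gE nge ngf => /(_ isT)/orP[]-> /(_ isT)/orP[]->;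
      by rewrite ?orbT.
  (* The two covers of [E] have together at most 2(t - 1) + 1 vertices, so one of them has fewer
     than t. *)
  move=> /minE + /minE; have := cardsU1 f.1 (A :|: A').
  by move: ltAB ltAB'; case: (_ \notin _); clear; lia.
case: (boolP (dinjectiveb (@snd S T) (mem E))) => [/dinjectiveP inj2|]; last first.
  case/dinjectivePn=> e eE [f]; rewrite inE => /andP[nfe fE] eq2.
  have [//|[A [B [cAB ltAB e1A e2B]]]] := step e eE.
  have [//|[A' [B' [cAB' ltAB' f1A f2B]]]] := step f fE.
  have := cardsUI A A'; have := cardsUI B B'.
  have: covers E (A :|: A') (B :&: B').
    apply/forall_inP => g gE; rewrite !inE.
    have [->|nge] := eqVneq g e.
      have := forall_inP cAB' e; rewrite !inE eE eq2 eq_sym nfe (negPf f2B) orbF.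
      by move=> -> //; rewrite ?orbT.
    have [->|ngf] := eqVneq g f.
      have := forall_inP cAB f; rewrite !inE fE nfe -eq2 (negPf e2B) orbF.
      by move=> -> //; rewrite ?orbT.
    have := forall_inP cAB g; have := forall_inP cAB' g.
    rewrite !inE gE nge ngf => /(_ isT)/orP[]-> /(_ isT)/orP[]->;
      by rewrite ?orbT.
  have: covers E (A :&: A') (f.2 |: (B :|: B')).
    apply/forall_inP => g gE; rewrite !inE.
    have [->|nge] := eqVneq g e; first by rewrite eq2 eqxx orbT.
    have [->|ngf] := eqVneq g f; first by rewrite eqxx orbT.
    have := forall_inP cAB g; have := forall_inP cAB' g.
    rewrite !inE gE nge ngf => /(_ isT)/orP[]-> /(_ isT)/orP[]->;
      by rewrite ?orbT.
  move=> /minE + /minE; have := cardsU1 f.2 (B :|: B').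
  by move: ltAB ltAB'; case: (_ \notin _); clear; lia.
(* Both projections are now injective on [E], so [E] is itself a matching; its left ends form a
   cover with as many vertices as [E] has edges. *)
exists E; split=> //; have := minE [set e.1 | e in E] set0.
rewrite cards0 addn0 card_in_imset //; apply.
by apply/forall_inP => e eE; rewrite imset_f.
Qed.

End Konig.

(** * Unit steps and windows *)

(** The head of the target is bubbled to the front by adjacent exchanges; the induction then goes on
    behind a growing prefix [p] that is already in place. *)
Lemma perm_eq_swap_ind (T : eqType) (Q : seq T -> Prop) :
    (forall s1 a b s2, Q (s1 ++ [:: a, b & s2]) -> Q (s1 ++ [:: b, a & s2])) ->
  forall s t, perm_eq s t -> Q s -> Q t.
Proof.
move=> swapQ; suff perQ t p s : perm_eq s t -> Q (p ++ s) -> Q (p ++ t).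
  by move=> s t; apply: (perQ t [::]).
elim: t p s => [|b t IHt] p s; first by move=> /perm_nilP->.
move=> eq_s; have b_s: b \in s by rewrite (perm_mem eq_s) inE eqxx.
case/splitPr: b_s eq_s => s1 s2 eq_s Qs.
rewrite -cat_rcons; apply: (IHt _ (s1 ++ s2)).
  by move: eq_s; rewrite perm_catC /= perm_cons perm_catC.
rewrite cat_rcons; elim/last_ind: s1 s2 Qs {eq_s} => // s1 a IHs s2.
by rewrite !cat_rcons catA => /swapQ; rewrite -catA => /IHs.
Qed.

Section WeightedSum.
Variable T : Type.
Implicit Types (c : nat -> T -> nat) (s : seq T).

(** Shifting the weight instead of carrying an index lets an adjacent exchange be treated by
    induction on the prefix, without a default value. *)
Fixpoint wsum c s :=
  if s is x :: s' then c 0 x + wsum (fun i => c i.+1) s' else 0.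

Lemma wsumE x0 c s : wsum c s = \sum_(i < size s) c i (nth x0 s i).
Proof. by elim: s c => [|x s IHs] c; rewrite ?big_ord0 // big_ord_recl /= IHs. Qed.

Lemma wsum_swap c s1 a b s2 d :
    (forall i a b, c i a + c i.+1 b <= c i b + c i.+1 a + d) ->
  wsum c (s1 ++ [:: a, b & s2]) <= wsum c (s1 ++ [:: b, a & s2]) + d.
Proof.
elim: s1 c => [|x s1 IHs] c swapc /=; first by have := swapc 0 a b; lia.
by have := IHs (fun i => c i.+1) (fun i => swapc i.+1); lia.
Qed.

End WeightedSum.

(** A sum above h is at least h + 2, since h + 1 is excluded; an adjacent exchange lowers it by at
    most 2, and h and h + 1 remain excluded, so it stays above h. *)
Lemma wsum_gap (T : eqType) (c : nat -> T -> nat) h s t :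
    (forall i a b, c i a + c i.+1 b <= c i b + c i.+1 a + 2) ->
    (forall u, perm_eq s u -> wsum c u != h /\ wsum c u != h.+1) ->
  perm_eq s t -> h < wsum c s -> h < wsum c t.
Proof.
move=> swapc gap eq_st lt_h.
suff: h < wsum c t /\ perm_eq s t by case.
apply: (perm_eq_swap_ind (Q := fun u => h < wsum c u /\ perm_eq s u)) eq_st _ => //.
move=> s1 a b s2 [lt_ab eq_ab].
have eq_ba : perm_eq s (s1 ++ [:: b, a & s2]).
  by rewrite (perm_trans eq_ab) // perm_cat2l (perm_catCA [:: a] [:: b] s2).
split=> //; have := wsum_swap s1 a b s2 swapc.
by have := gap _ eq_ab; have := gap _ eq_ba; lia.
Qed.

Lemma sum_negb m (d : nat -> bool) :
  \sum_(i < m) ~~ d i = m - \sum_(i < m) d i.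
Proof.
apply/eqP; rewrite -(eqn_add2r (\sum_(i < m) d i)) -big_split /=.
rewrite (eq_bigr (fun=> 1)) => [|i _]; last by case: (d i).
rewrite sum_nat_const card_ord muln1 subnK // -[leqRHS]muln1 -[m in leqRHS]card_ord.
by rewrite -sum_nat_const; apply: leq_sum => i _; case: (d i).
Qed.

Lemma sum_pairs (F : nat -> nat) h :
  \sum_(i < 2 * h) F i = \sum_(i < h) (F (2 * i) + F (2 * i + 1)).
Proof.
elim: h => [|h IHh]; first by rewrite !big_ord0.
by rewrite mulnS !big_ord_recr /= IHh addn1 addnA.
Qed.

(* The windows of length 2h move in unit steps; were they all above h, then any
   two consecutive values would sum to at most 1, and the windows, being
   unions of h pairs, would be at most h. *)
Lemma window_le (c : nat -> bool) h :
    (forall i, c (i + (2 * h + 2)) = c i) ->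
    \sum_(i < 2 * h + 1) c i <= h.+1 ->
  exists t, \sum_(i < 2 * h) c (t + i) <= h.
Proof.
move=> perc leh; pose D t := \sum_(i < 2 * h) c (t + i).
case: (boolP [exists t : 'I_(2 * h + 2), D t <= h]) => [/existsP[t]|]; first by exists t.
move=> /existsPn gtD; pose S t := \sum_(i < 2 * h + 2) c (t + i).
have SD t : S t = D t + c (t + 2 * h) + c (t + 2 * h).+1.
  by rewrite /S addn2 !big_ord_recr /= addnS.
have S0 t : S t = S 0.
  elim: t => // t <-; rewrite /S addn2 big_ord_recr [in RHS]big_ord_recl /=.
  rewrite addn0 addnC; congr (_ + _); first by rewrite addSnnS -addn2 perc.
  by apply: eq_bigr => i _; rewrite addSnnS.
have gtDt t : t <= 2 * h -> h < D t.
  by move=> le_t; rewrite ltnNge; have /= := gtD (Ordinal (_ : t < 2 * h + 2)); apply; lia.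
have gtD0 := gtDt 0 isT; have := gtDt (2 * h) (leqnn _).
have eqf : \sum_(i < 2 * h + 1) c i = D 0 + c (2 * h) by rewrite addn1 big_ord_recr.
(* Here [D 0 = h + 1] and [c (2 * h)] is false, so every [S t] is at most h + 2; as [D (2 * i) > h],
   the two positions following that window hold at most one true value. *)
suff: D (2 * h) <= h by lia.
rewrite /D (sum_pairs (fun i => c (2 * h + i))) -[leqRHS]muln1 -[X in X * 1]card_ord -sum_nat_const.
apply: leq_sum => i _; have := SD (2 * i); have := S0 (2 * i); have := SD 0.
have := gtDt (2 * i); have := ltn_ord i.
have -> : 2 * i + 2 * h = 2 * h + 2 * i by lia.
have -> : 2 * h + (2 * i + 1) = (2 * h + 2 * i).+1 by lia.
by rewrite add0n; lia.
Qed.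

Lemma unit_step_ivt (D : nat -> nat) a b h :
    (forall t, D t.+1 <= (D t).+1) -> a <= b -> D a <= h -> h <= D b ->
  exists t, D t = h.
Proof.
move=> stepD /subnK <-; elim: (b - a) => [|d IHd] leDa leDb.
  by exists a; apply/eqP; rewrite eqn_leq leDa.
have [/IHd|ltDh] := leqP h (D (d + a)); first exact.
by exists (d.+1 + a); have := stepD (d + a); rewrite -addSn; lia.
Qed.

(** One window has at most h true values, another at least h, and sliding a window by one position
    changes its count by at most 1. *)
Lemma balanced_window (c : nat -> bool) h :
    (forall i, c (i + (2 * h + 2)) = c i) ->
    h <= \sum_(i < 2 * h + 1) c i <= h.+1 ->
  exists t, \sum_(i < 2 * h) c (t + i) = h.
Proof.
move=> perc /andP[geh leh].
have [a leDa] := window_le perc leh.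
(* The negated sequence satisfies the same bound; its window with at most h true values is one of
   [c] with at least h. *)
have [||b] := @window_le (fun i => ~~ c i) h; first by move=> i; rewrite perc.
  by rewrite sum_negb; lia.
rewrite (sum_negb _ (fun i => c (b + i))) => geDb.
pose D t := \sum_(i < 2 * h) c (t + i); rewrite -/(D b) in geDb.
have perD t m : D (t + m * (2 * h + 2)) = D t.
  elim: m => [|m IHm]; first by rewrite mul0n addn0.
  rewrite -IHm; apply: eq_bigr => i _; rewrite mulSn -[in RHS]perc; congr (nat_of_bool (c _)).
  lia.
(* Moving [b] forward by [a] periods places it after [a]. *)
apply: (@unit_step_ivt D a (b + a * (2 * h + 2))); rewrite ?perD //; try lia.
move=> t; rewrite -(leq_add2r (c t)).
have -> : D t.+1 + c t = D t + c (t + 2 * h).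
  transitivity (\sum_(i < (2 * h).+1) c (t + i)); last by rewrite big_ord_recr.
  rewrite big_ord_recl /= addn0 addnC; congr (_ + _).
  by apply: eq_bigr => i _; rewrite addSnnS.
by case: (c _); case: (c t); lia.
Qed.

(** * Copies of paths *)

Lemma sum_bool_card (I : finType) (P : pred I) : \sum_i P i = #|[set i | P i]|.
Proof. by rewrite -sum1dep_card [RHS]big_mkcond; apply: eq_bigr => i _; case: (P i). Qed.

Section BipartiteCopies.
Variable n : nat.
Implicit Types (Q R : {set 'I_n * 'I_n}) (x y : 'I_n + 'I_n) (e : 'I_n * 'I_n).

(* Junk value when [x] and [y] are on the same side. *)
Definition edge_of x y : 'I_n * 'I_n :=
  match x, y with
  | inl a, inr b | inr b, inl a => (a, b)
  | inl a, inl _ | inr a, inr _ => (a, a)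
  end.

Lemma bip_adj_edge_of Q x y : bip_adj setT x y -> bip_adj Q x y = (edge_of x y \in Q).
Proof. by case: x y => [a|b] [a'|b']. Qed.

Lemma edge_of_inj x y x' y' :
    bip_adj setT x y -> bip_adj setT x' y' -> edge_of x y = edge_of x' y' ->
  (x = x' /\ y = y') \/ (x = y' /\ y = x').
Proof.
by case: x y x' y' => [a|b] [a'|b'] [c|d] [c'|d'] //= _ _ [-> ->]; [left|right|right|left].
Qed.

Lemma bip_adjC Q x y : bip_adj setT x y -> bip_adj (~: Q) x y = ~~ bip_adj Q x y.
Proof. by case: x y => [a|b] [a'|b'] //= _; rewrite inE. Qed.

(** The steps of the path index the edges of the copy bijectively, which turns a cardinality into a
    sum over positions. *)
Lemma copy_edges_path m (f : path_graph m -> complete_bip n n) Q :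
    embedding f ->
  #|copy_edges f :&: Q| =
    \sum_(i < m) bip_adj Q (f (widen_ord (leqnSn m) i)) (f (lift ord0 i)).
Proof.
case=> injf homf; pose src (i : 'I_m) := widen_ord (leqnSn m) i.
pose tgt (i : 'I_m) : 'I_m.+1 := lift ord0 i.
have fst_adj i : bip_adj setT (f (src i)) (f (tgt i)).
  by apply: homf; rewrite /= /path_adj /src /tgt lift0 eqxx.
pose ed i := edge_of (f (src i)) (f (tgt i)).
have inj_ed : injective ed.
  move=> i j /edge_of_inj[] // [/injf eq1 /injf eq2]; apply: val_inj.
    by have /= := congr1 val eq1.
  (* The same edge traversed backwards would give both i = j + 1 and j = i + 1. *)
  have := congr1 (@nat_of_ord _) eq1; have := congr1 (@nat_of_ord _) eq2.
  by rewrite !lift0 /=; lia.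
rewrite (sum_bool_card (fun i => bip_adj Q (f (src i)) (f (tgt i)))).
rewrite -(card_imset _ inj_ed); apply: eq_card => e; rewrite !inE.
apply/andP/imsetP => [[/existsP[u /existsP[v /and3P[uv /eqP fu /eqP fv]]] eQ]|].
  have lt_u : u < m.+1 by []. have lt_v : v < m.+1 by [].
  case/orP: uv => [/eqP uv|/eqP vu].
    have lt_um : u < m by lia.
    have su : src (Ordinal lt_um) = u by apply: val_inj.
    have tv : tgt (Ordinal lt_um) = v by apply: val_inj; rewrite /= /bump.
    exists (Ordinal lt_um); first by rewrite inE su tv fu fv /= -surjective_pairing.
    by rewrite /ed su tv fu fv; case: (e).
  have lt_vm : v < m by lia.
  have sv : src (Ordinal lt_vm) = v by apply: val_inj.
  have tu : tgt (Ordinal lt_vm) = u by apply: val_inj; rewrite /= /bump.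
  exists (Ordinal lt_vm); first by rewrite inE sv tu fu fv /= -surjective_pairing.
  by rewrite /ed sv tu fu fv; case: (e).
case=> i; rewrite inE bip_adj_edge_of // => eQ ->; split=> //.
have := fst_adj i; rewrite /ed; have st : @adj (path_graph m) (src i) (tgt i).
  by rewrite /= /path_adj lift0 eqxx.
case Es: (f (src i)) => [a|b]; case Et: (f (tgt i)) => [a'|b'] //= _.
  apply/existsP; exists (src i); apply/existsP; exists (tgt i).
  by apply/and3P; rewrite Es Et.
apply/existsP; exists (tgt i); apply/existsP; exists (src i); apply/and3P.
by rewrite Es Et; split=> //; rewrite [_ _ _](@path_adj_sym m).
Qed.

Lemma copy_edges_pathC m (f : path_graph m -> complete_bip n n) Q :
  embedding f -> #|copy_edges f :&: ~: Q| = m - #|copy_edges f :&: Q|.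
Proof.
move=> embf; rewrite !copy_edges_path //.
apply/eqP; rewrite -(eqn_add2r (\sum_(i < m) bip_adj Q (f (widen_ord (leqnSn m) i)) (f (lift ord0 i)))).
have adjf (i : 'I_m) : bip_adj setT (f (widen_ord (leqnSn m) i)) (f (lift ord0 i)).
  by apply: embf.2; rewrite /= /path_adj lift0 eqxx.
have sum_m : \sum_(i < m) 1 = m by rewrite sum_nat_const card_ord muln1.
rewrite subnK; last first.
  by rewrite -[leqRHS]sum_m; apply: leq_sum => i _; case: (bip_adj _ _ _).
rewrite -big_split -[X in _ == X]sum_m; apply/eqP/eq_bigr => i _.
by rewrite /= bip_adjC //; case: (bip_adj Q _ _).
Qed.

End BipartiteCopies.

Lemma has_balanced_copyC n (G : sgraph) (R : {set 'I_n * 'I_n}) :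
  has_balanced_copy G (~: R) -> has_balanced_copy G R.
Proof. by case=> f [embf]; rewrite setCK => le1 le2; exists f. Qed.

Section Zigzag.
Variables (n h : nat) (x0 : 'I_n).
Implicit Types (R : {set 'I_n * 'I_n}) (X Y : seq 'I_n).

(* The closed walk x_0 y_0 x_1 y_1 ... x_h y_h x_0, indexed periodically. *)
Definition zigzag X Y j : 'I_n + 'I_n :=
  let i := j %% (2 * h + 2) in
  if odd j then inr (nth x0 Y i./2) else inl (nth x0 X i./2).

Definition zred R X Y j : bool := bip_adj R (zigzag X Y j) (zigzag X Y j.+1).

(** The closing edge y_h x_0, at position 2h + 1, is left out: what remains is a path with 2h + 1
    edges. *)
Definition reds R X Y := \sum_(i < 2 * h + 1) zred R X Y i.

Lemma zigzagD X Y j : zigzag X Y (j + (2 * h + 2)) = zigzag X Y j.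
Proof. by rewrite /zigzag modnDr oddD addn2 mul2n /= odd_double addbF. Qed.

Lemma zigzag_adj X Y j : bip_adj setT (zigzag X Y j) (zigzag X Y j.+1).
Proof. by rewrite /zigzag /=; case: (odd j); rewrite /= inE. Qed.

Lemma zredC R X Y j : zred (~: R) X Y j = ~~ zred R X Y j.
Proof. exact/bip_adjC/zigzag_adj. Qed.

Lemma redsC R X Y : reds (~: R) X Y = 2 * h + 1 - reds R X Y.
Proof. by rewrite /reds -sum_negb; apply: eq_bigr => i _; rewrite zredC. Qed.

(** The side of a vertex gives the parity of its position, which reduction modulo the even period
    keeps, and its rank in [X] or [Y] gives the half of the residue. *)
Lemma zigzag_inj X Y t u v :
    uniq X -> uniq Y -> h < size X -> h < size Y ->
    u < 2 * h + 2 -> v < 2 * h + 2 ->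
  zigzag X Y (t + u) = zigzag X Y (t + v) -> u = v.
Proof.
move=> uX uY hX hY ltu ltv eq_uv.
suff: (t + u) %% (2 * h + 2) == (t + v) %% (2 * h + 2).
  by rewrite eqn_modDl !modn_small // => /eqP.
have odd_z j : odd j = odd (j %% (2 * h + 2)).
  by rewrite odd_mod // addn2 mul2n /= odd_double.
have lt_z j : (j %% (2 * h + 2))./2 <= h.
  by have := @ltn_pmod j (2 * h + 2); lia.
have hl j := odd_double_half (j %% (2 * h + 2)).
have := hl (t + u); have := hl (t + v); move: eq_uv; rewrite /zigzag -!odd_z.
case: (odd (t + u)); case: (odd (t + v)) => //= -[/eqP];
  by rewrite nth_uniq ?(leq_ltn_trans (lt_z _)) // => /eqP-> -> ->.
Qed.

(** At most 2h + 1 consecutive edges of the closed walk meet at most 2h + 2 distinct vertices, so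
    they form a path wherever they start. *)
Lemma zigzag_balanced R X Y t m :
    uniq X -> uniq Y -> h < size X -> h < size Y -> m <= 2 * h + 1 ->
    \sum_(i < m) zred R X Y (t + i) <= m - \sum_(i < m) zred R X Y (t + i) + 1 ->
    m - \sum_(i < m) zred R X Y (t + i) <= \sum_(i < m) zred R X Y (t + i) + 1 ->
  has_balanced_copy (path_graph m) R.
Proof.
move=> uX uY hX hY le_m.
pose f (v : path_graph m) : complete_bip n n := zigzag X Y (t + nat_of_ord v).
have embf : embedding f.
  split=> [u v eq_uv|u v].
    apply: val_inj; apply: (zigzag_inj uX uY hX hY _ _ eq_uv).
      by have := ltn_ord u; lia.
    by have := ltn_ord v; lia.
  rewrite /= /path_adj /f => /orP[] /eqP <-; rewrite addnS; last rewrite bip_adj_sym;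
    exact: zigzag_adj.
have -> : \sum_(i < m) zred R X Y (t + i) = #|copy_edges f :&: R|.
  by rewrite copy_edges_path //; apply: eq_bigr => i _; rewrite /f lift0 addnS.
by rewrite -copy_edges_pathC // => le1 le2; exists f.
Qed.

(** For 2h + 1 edges the open walk is already balanced; for 2h edges a suitable window of the closed
    walk has exactly h red edges. *)
Lemma balanced_of_reds R X Y m :
    uniq X -> uniq Y -> h < size X -> h < size Y ->
    h <= reds R X Y <= h.+1 -> m = 2 * h \/ m = 2 * h + 1 ->
  has_balanced_copy (path_graph m) R.
Proof.
move=> uX uY hX hY reds_h [->|->]; last first.
  by apply: (@zigzag_balanced R X Y 0) => //; rewrite -/(reds R X Y); lia.
have [|t Dt] := @balanced_window (zred R X Y) h _ reds_h.
  by move=> i; rewrite /zred -addSn !zigzagD.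
by apply: (zigzag_balanced (t := t) uX uY hX hY); rewrite ?Dt; lia.
Qed.

Lemma redsE R X Y :
  reds R X Y = \sum_(i < h.+1) ((nth x0 X i, nth x0 Y i) \in R)
             + \sum_(i < h) ((nth x0 X i.+1, nth x0 Y i) \in R).
Proof.
have zred_even i : i <= h -> zred R X Y (2 * i) = ((nth x0 X i, nth x0 Y i) \in R).
  move=> le_i; rewrite /zred /zigzag /= mul2n odd_double /= -mul2n !modn_small; try lia.
  by have [-> ->] : (2 * i)./2 = i /\ (2 * i).+1./2 = i by lia.
have zred_odd i : i < h -> zred R X Y (2 * i + 1) = ((nth x0 X i.+1, nth x0 Y i) \in R).
  move=> lt_i; rewrite /zred /zigzag /= addn1 /= mul2n odd_double /= -mul2n !modn_small; try lia.
  by have [-> ->] : (2 * i).+1./2 = i /\ (2 * i).+2./2 = i.+1 by lia.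
rewrite /reds addn1 big_ord_recr /= (sum_pairs (fun i => zred R X Y i)) big_split /=.
rewrite addnAC zred_even // big_ord_recr /=; congr (_ + _ + _).
  by apply: eq_bigr => i _; rewrite zred_even // ltnW.
by apply: eq_bigr => i _; rewrite zred_odd.
Qed.

Lemma reds_wsumr R X Y : size Y = n -> h < n ->
  reds R X Y =
    wsum (fun i y => (i <= h) * ((nth x0 X i, y) \in R)
                   + (i < h) * ((nth x0 X i.+1, y) \in R)) Y.
Proof.
move=> sY lt_hn; rewrite redsE (wsumE x0) sY big_split /=; congr (_ + _).
  rewrite (big_ord_widen n (fun i => ((nth x0 X i, nth x0 Y i) \in R) : nat) lt_hn) big_mkcond.
  apply: eq_bigr => i _.
  by rewrite ltnS; case: (i <= h); rewrite ?mul1n.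
rewrite (big_ord_widen n (fun i => ((nth x0 X i.+1, nth x0 Y i) \in R) : nat) (ltnW lt_hn)) big_mkcond.
apply: eq_bigr => i _.
by case: (i < h); rewrite ?mul1n.
Qed.

(** The first vertex x_0 has no predecessor on the open walk; the guard [0 < i] also neutralizes the
    value of [i.-1] at 0. *)
Lemma reds_wsuml R X Y : size X = n -> h < n ->
  reds R X Y =
    wsum (fun i x => (i <= h) * ((x, nth x0 Y i) \in R)
                   + (0 < i <= h) * ((x, nth x0 Y i.-1) \in R)) X.
Proof.
move=> sX lt_hn; rewrite redsE (wsumE x0) sX big_split /=; congr (_ + _).
  rewrite (big_ord_widen n (fun i => ((nth x0 X i, nth x0 Y i) \in R) : nat) lt_hn) big_mkcond.
  apply: eq_bigr => i _.
  by rewrite ltnS; case: (i <= h); rewrite ?mul1n.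
have -> : \sum_(i < h) ((nth x0 X i.+1, nth x0 Y i) \in R) =
          \sum_(i < h.+1) (0 < i) * ((nth x0 X i, nth x0 Y i.-1) \in R).
  by rewrite big_ord_recl; apply: eq_bigr => i _; rewrite mul1n.
rewrite (big_ord_widen n (fun i => (0 < i) * ((nth x0 X i, nth x0 Y i.-1) \in R)) lt_hn) big_mkcond.
apply: eq_bigr => i _.
by rewrite ltnS; case: (i <= h); rewrite ?andbF ?andbT.
Qed.

(** Index 1 marks the common neighbor of the two exchanged vertices. If [q] holds, its edges to both
    count before and after; in either case at most two red edges can be lost. *)
Fact exchange_l (p p' q a0 a1 a2 b0 b1 b2 : bool) : q ==> p ->
  p * a1 + p' * a0 + (q * b2 + q * b1) <= p * b1 + p' * b0 + (q * a2 + q * a1) + 2.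
Proof.
by case: p; case: p'; case: q; case: a0; case: a1; case: a2; case: b0; case: b1; case: b2.
Qed.

Fact exchange_r (p q r a1 a2 a3 b1 b2 b3 : bool) :
  p * a1 + q * a2 + (q * b2 + r * b3) <= p * b1 + q * b2 + (q * a2 + r * a3) + 2.
Proof.
by case: p; case: q; case: r; case: a1; case: a2; case: a3; case: b1; case: b2; case: b3.
Qed.

(* Exchanging two consecutive vertices on the same side of the walk, or the last
   one with an unused vertex, changes the number of red edges by at most 2. *)
Lemma reds_gap R X Y X' Y' m :
    m = 2 * h \/ m = 2 * h + 1 -> ~ has_balanced_copy (path_graph m) R ->
    h < n -> perm_eq (enum 'I_n) X -> perm_eq (enum 'I_n) Y ->
    perm_eq X X' -> perm_eq Y Y' ->
  h < reds R X Y -> h < reds R X' Y'.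
Proof.
move=> mh nobal lt_hn pX pY pX' pY'.
have full Z : perm_eq (enum 'I_n) Z -> uniq Z /\ size Z = n.
  by move=> pZ; rewrite -(perm_uniq pZ) -(perm_size pZ) enum_uniq size_enum_ord.
have gap Z1 Z2 : perm_eq (enum 'I_n) Z1 -> perm_eq (enum 'I_n) Z2 ->
    reds R Z1 Z2 != h /\ reds R Z1 Z2 != h.+1.
  move=> /full[u1 s1] /full[u2 s2].
  have [reds_h|] := boolP (h <= reds R Z1 Z2 <= h.+1); last lia.
  by case: nobal; apply: (balanced_of_reds u1 u2) => //; rewrite ?s1 ?s2.
have [uX sX] := full X pX; have [uY sY] := full Y pY.
have pX'' := perm_trans pX pX'; have [uX' sX'] := full X' pX''.
have [uY' sY'] := full Y' (perm_trans pY pY').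
move=> gtXY; have: h < reds R X' Y.
  move: gtXY; rewrite !reds_wsuml //; apply: wsum_gap pX' => [i a b|Z pZ].
    by apply: exchange_l; apply/implyP/ltnW.
  have pZ' := perm_trans pX pZ; rewrite -reds_wsuml; first exact: gap.
    by case: (full Z pZ').
  by [].
rewrite !reds_wsumr //; apply: wsum_gap pY' => [i a b|Z pZ].
  exact: exchange_r.
have pZ' := perm_trans pY pZ; rewrite -reds_wsumr; first exact: gap.
  by case: (full Z pZ').
by [].
Qed.

End Zigzag.

(** * Long red paths *)

Lemma pick_notin (T : finType) (A : {set T}) (s : seq T) :
  size s < #|A| -> exists2 x, x \in A & x \notin s.
Proof.
move=> lt_s; suff /subsetPn[x]: ~~ (A \subset s) by exists x.
by apply: contraL lt_s => /subset_leq_card leA; rewrite -leqNgt (leq_trans leA) ?card_size.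
Qed.

Lemma pick2_notin (T : finType) (A : {set T}) (s : seq T) :
    size s + 2 <= #|A| ->
  exists x y, [/\ x \in A, y \in A, x \notin s, y \notin s & x != y].
Proof.
move=> le_s; have [|x xA xs] := @pick_notin _ A s; first lia.
have [|y yA] := @pick_notin _ A (x :: s); first by rewrite /=; lia.
by rewrite inE negb_or eq_sym => /andP[xy ys]; exists x, y.
Qed.

Section RedPairs.
Variable n : nat.
Implicit Types (R M : {set 'I_n * 'I_n}) (P : seq ('I_n * 'I_n)) (L B SL SR : seq 'I_n).

(* Number of red edges of the path l_0 r_0 l_1 r_1 ... with l_i, r_i the
   components of the i-th pair. *)
Fixpoint red_pairs R P : nat :=
  if P is p :: P' then
    (p \in R) + (if P' is q :: _ then (q.1, p.2) \in R : nat else 0) + red_pairs R P'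
  else 0.

Lemma red_pairsE x0 R P :
  red_pairs R P =
    \sum_(i < size P) ((nth x0 (unzip1 P) i, nth x0 (unzip2 P) i) \in R) +
    \sum_(i < (size P).-1) ((nth x0 (unzip1 P) i.+1, nth x0 (unzip2 P) i) \in R).
Proof.
elim: P => [|p [|q P] IHP]; first by rewrite !big_ord0.
  by rewrite /= big_ord1 big_ord0 !addn0 -surjective_pairing.
rewrite [LHS]/= -/(red_pairs R (q :: P)) IHP.
rewrite [X in _ = X + _]big_ord_recl [X in _ = _ + X]big_ord_recl.
by rewrite addnACA /= -surjective_pairing.
Qed.

Lemma reds_red_pairs h x0 R P X Y : size P = h.+1 ->
  reds h x0 R (unzip1 P ++ X) (unzip2 P ++ Y) = red_pairs R P.
Proof.
move=> sP; rewrite redsE (red_pairsE x0) sP; congr (_ + _); apply: eq_bigr => i _;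
  have := ltn_ord i; rewrite !nth_cat !size_map sP => lt_i; rewrite !ifT //; lia.
Qed.

Definition nbrs1 R l := [set r | (l, r) \in R].
Definition nbrs2 R r := [set l | (l, r) \in R].

Lemma red_pairs_left_stars R h L B P :
    h < n -> (forall l : 'I_n, l \in L -> h <= #|nbrs1 R l|) ->
    uniq (L ++ unzip1 P) -> uniq (B ++ unzip2 P) ->
    size P + 2 * size L + size B <= h ->
  exists P', [/\ size P' = size P + 2 * size L, uniq (unzip1 P'),
    uniq (B ++ unzip2 P') & red_pairs R P + 2 * size L <= red_pairs R P'].
Proof.
move=> lt_hn; elim: L P => [|l L IHL] P degL uL uB /= le_h.
  by exists P; rewrite muln0 !addn0.
have sz2 : size (B ++ unzip2 P) = size B + size P by rewrite size_cat size_map.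
have sz1 : size (L ++ unzip1 P) = size L + size P by rewrite size_cat size_map.
have [|r1 [r2]] := @pick2_notin _ (nbrs1 R l) (B ++ unzip2 P).
  by apply: leq_trans (degL l (mem_head _ _)); rewrite sz2; lia.
rewrite !inE => -[lr1 lr2 r1U r2U r12].
have [|l' _ l'U] := @pick_notin _ [set: 'I_n] (l :: L ++ unzip1 P).
  by rewrite cardsT card_ord /= sz1; lia.
have [||||P' [sP' u1 u2 leP']] := IHL ((l', r1) :: (l, r2) :: P).
- by move=> l0 l0L; apply: degL; rewrite inE l0L orbT.
- by rewrite (uniq_catCA L [:: l'; l]) [uniq _]/= l'U.
- rewrite (uniq_catCA B [:: r1; r2]) /= inE negb_or r12 r1U r2U.
  exact: uB.
- by move: le_h; rewrite /=; clear; lia.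
exists P'; split=> //; first by rewrite sP' /=; clear; lia.
by move: leP'; rewrite /= lr1 lr2; clear; lia.
Qed.

(** Mirror construction, with stretches l1 r l2 r' around each center r. *)
Lemma red_pairs_right_stars R h L P :
    h < n -> (forall r : 'I_n, r \in L -> h <= #|nbrs2 R r|) ->
    uniq (unzip1 P) -> uniq (L ++ unzip2 P) -> size P + 2 * size L <= h ->
  exists P', [/\ size P' = size P + 2 * size L, uniq (unzip1 P'),
    uniq (unzip2 P') & red_pairs R P + 2 * size L <= red_pairs R P'].
Proof.
move=> lt_hn; elim: L P => [|r L IHL] P degL u1 uL /= le_h.
  by exists P; rewrite muln0 !addn0.
have sz1 : size (unzip1 P) = size P by rewrite size_map.
have sz2 : size (L ++ unzip2 P) = size L + size P by rewrite size_cat size_map.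
have [|l1 [l2]] := @pick2_notin _ (nbrs2 R r) (unzip1 P).
  by apply: leq_trans (degL r (mem_head _ _)); rewrite sz1; lia.
rewrite !inE => -[l1r l2r l1U l2U l12].
have [|r' _ r'U] := @pick_notin _ [set: 'I_n] (r :: L ++ unzip2 P).
  by rewrite cardsT card_ord /= sz2; lia.
have [||||P' [sP' u1' u2' leP']] := IHL ((l1, r) :: (l2, r') :: P).
- by move=> r0 r0L; apply: degL; rewrite inE r0L orbT.
- by rewrite /= inE negb_or l12 l1U l2U.
- rewrite (uniq_catCA L [:: r; r']) /= inE negb_or.
  by move: r'U uL; rewrite inE negb_or eq_sym /= => /andP[-> ->] /andP[-> ->].
- by move: le_h; rewrite /=; clear; lia.
exists P'; split=> //; first by rewrite sP' /=; clear; lia.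
by move: leP'; rewrite /= l1r l2r; clear; lia.
Qed.

Lemma red_pairs_pad R P :
    size P < n -> uniq (unzip1 P) -> uniq (unzip2 P) ->
  exists P', [/\ size P' = (size P).+1, uniq (unzip1 P'), uniq (unzip2 P') &
    red_pairs R P <= red_pairs R P'].
Proof.
move=> lt_n u1 u2; have [|l _ lP] := @pick_notin _ [set: 'I_n] (unzip1 P).
  by rewrite cardsT card_ord size_map.
have [|r _ rP] := @pick_notin _ [set: 'I_n] (unzip2 P).
  by rewrite cardsT card_ord size_map.
by exists ((l, r) :: P); rewrite /= lP rP; split=> //; lia.
Qed.

Lemma red_pairs_cons R p P : (p \in R) + red_pairs R P <= red_pairs R (p :: P).
Proof. by rewrite leq_add2r leq_addr. Qed.

(** The matching edges serve as the pairs, in any order; the edges linking them may have any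
    color. *)
Lemma red_pairs_matching R M : M \subset R -> matching M ->
  exists P, [/\ size P = #|M|, uniq (unzip1 P), uniq (unzip2 P) & #|M| <= red_pairs R P].
Proof.
move=> sMR [inj1 inj2]; exists (enum M); rewrite -cardE.
rewrite !map_inj_in_uniq ?enum_uniq; first 1 last.
- by move=> e f; rewrite !mem_enum; apply: inj2.
- by move=> e f; rewrite !mem_enum; apply: inj1.
split=> //; rewrite cardE.
have: {subset enum M <= R} by move=> e; rewrite mem_enum; apply: (subsetP sMR).
elim: (enum M) => // p P IHP sPR; apply: leq_trans (red_pairs_cons _ _ _).
rewrite sPR ?mem_head // ltnS IHP // => e eP; apply: sPR; exact: mem_behead.
Qed.

Definition long_red_path R h :=
  exists P, [/\ size P = h.+1, uniq (unzip1 P), uniq (unzip2 P) & h <= red_pairs R P].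

(** Each star adds two pairs and two red edges, which makes h pairs with at least h red edges; one
    pair of arbitrary colors completes the path. *)
Lemma long_red_path_of_stars R h SL SR P :
    h < n -> (forall l : 'I_n, l \in SL -> h <= #|nbrs1 R l|) ->
    (forall r : 'I_n, r \in SR -> h <= #|nbrs2 R r|) ->
    uniq (SL ++ unzip1 P) -> uniq (SR ++ unzip2 P) ->
    size P + 2 * (size SL + size SR) = h -> size P <= red_pairs R P ->
  long_red_path R h.
Proof.
move=> lt_hn dL dR uL uR size_h redP.
have [|P1 [s1 u1 v1 r1]] := red_pairs_left_stars lt_hn dL uL uR; first lia.
have [|P2 [s2 u2 v2 r2]] := red_pairs_right_stars lt_hn dR u1 v1; first lia.
have [|P3 [s3 u3 v3 r3]] := @red_pairs_pad R P2 _ u2 v2; first lia.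
exists P3; split=> //; first by rewrite s3; move: s1 s2 size_h; clear; lia.
by move: r1 r2 r3 size_h redP; clear; lia.
Qed.

(* Two edges with a common end occupy two pairs, one of which needs a vertex
   that is not otherwise used. *)
Lemma red_pairs_few_edges R SL SR eps :
    eps <= 1 -> size SL + size SR + 1 < n -> uniq SL -> uniq SR ->
    eps < #|[set e in R | (e.1 \notin SL) && (e.2 \notin SR)]| ->
  exists P, [/\ size P = eps.+1, uniq (SL ++ unzip1 P), uniq (SR ++ unzip2 P) &
    size P <= red_pairs R P].
Proof.
have uniq1 (S : seq 'I_n) x : uniq S -> x \notin S -> uniq (S ++ [:: x]).
  by move=> uS xS; rewrite cats1 rcons_uniq xS.
have uniq2 (S : seq 'I_n) x y :
    uniq S -> x \notin S -> y \notin S -> x != y -> uniq (S ++ [:: x; y]).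
  by move=> uS xS yS xy; rewrite uniq_catC /= inE negb_or xy xS yS.
case: eps => [|[|//]] _ lt_n uL uR.
  case/card_gt0P=> e; rewrite inE => /and3P[eR eL e'R].
  exists [:: e]; rewrite /= eR; split=> //; exact: uniq1.
case/card_gt1P=> e [f []]; rewrite !inE.
case: e f => [a b] [c d] /= /and3P[abR aL bR] /and3P[cdR cL dR] nef.
have [eq1|nac] := eqVneq a c.
  have [|x _] := @pick_notin _ [set: 'I_n] (a :: SL).
    by rewrite cardsT card_ord /=; move: lt_n; clear; lia.
  rewrite inE negb_or => /andP[xa xL]; rewrite -eq1 in cdR nef.
  exists [:: (x, b); (a, d)]; rewrite /= abR cdR; split=> //.
  - exact: uniq2.
  - by apply: uniq2 => //; apply: contraNneq nef => ->.
  - by case: (_ \in R).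
have [eq2|nbd] := eqVneq b d.
  have [|x _] := @pick_notin _ [set: 'I_n] (b :: SR).
    by rewrite cardsT card_ord /=; move: lt_n; clear; lia.
  rewrite inE negb_or => /andP[xb xR]; rewrite -eq2 in cdR nef.
  exists [:: (a, b); (c, x)]; rewrite /= abR cdR; split=> //.
  - exact: uniq2.
  - by apply: uniq2; rewrite // eq_sym.
exists [:: (a, b); (c, d)]; rewrite /= abR cdR.
by split=> //; [apply: uniq2 | apply: uniq2 | case: (_ \in R)].
Qed.

End RedPairs.

(** * Edge counts through small covers, and the extremal structure *)

Lemma sum_le_threshold (T : finType) (A : {set T}) (d : T -> nat) m h :
    (forall x, d x <= m) ->
  \sum_(x in A) d x <=
    #|[set x in A | h <= d x]| * m + (#|A| - #|[set x in A | h <= d x]|) * h.-1.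
Proof.
move=> le_m; rewrite (bigID (fun x => h <= d x)) /= leq_add //.
  rewrite -sum1dep_card big_distrl /=; apply: leq_sum => x _; by rewrite mul1n.
have -> : #|A| - #|[set x in A | h <= d x]| = #|[set x in A | ~~ (h <= d x)]|.
  rewrite -(cardsID [set x in A | h <= d x] A).
  have -> : A :&: [set x in A | h <= d x] = [set x in A | h <= d x].
    by apply/setP=> x; rewrite !inE andbA andbb.
  rewrite addKn; apply: eq_card => x; by rewrite !inE; case: (x \in A); rewrite ?andbT.
by rewrite -sum1dep_card big_distrl /=; apply: leq_sum => x /andP[_]; rewrite mul1n; lia.
Qed.

Lemma subset_of_card (T : finType) (A : {set T}) m :
  m <= #|A| -> exists2 B : {set T}, B \subset A & #|B| = m.
Proof.
move=> le_m; exists [set x in take m (enum A)].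
  by apply/subsetP=> x; rewrite inE => /mem_take; rewrite mem_enum.
rewrite cardsE (card_uniqP _) ?take_uniq ?enum_uniq // size_take -cardE.
by case: ltngtP le_m.
Qed.

Section Dichotomy.
Variable n : nat.
Implicit Types (R U : {set 'I_n * 'I_n}) (A B : {set 'I_n}).

Definition transpose R := [set e | (e.2, e.1) \in R].

(* [R] is K_{s,n} plus [eps] edges, the side of size [n] being the right one. *)
Definition star_shaped R s eps :=
  exists A U, [/\ #|A| = s, #|U| = eps, [disjoint U & setX A setT] & R = setX A setT :|: U].

Lemma card_transpose R : #|transpose R| = #|R|.
Proof.
have inj_swap : injective (fun e : 'I_n * 'I_n => (e.2, e.1)) by case=> a b [c d] [-> ->].
rewrite -(card_imset R inj_swap); apply: eq_card => -[a b]; rewrite inE /=.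
by apply/idP/imsetP => [baR|[[c d] cdR [-> ->]]] //; exists (b, a).
Qed.

Lemma card_covered_le R A B : covers R A B ->
  #|R| <= \sum_(l in A) #|nbrs1 R l| + \sum_(r in B) #|nbrs2 R r|.
Proof.
move=> cR; have -> : \sum_(l in A) #|nbrs1 R l| = #|[set e in R | e.1 \in A]|.
  transitivity (\sum_(l in A) \sum_(r | (l, r) \in R) 1).
    by apply: eq_bigr => l _; rewrite sum1dep_card.
  rewrite pair_big_dep /= sum1dep_card; apply: eq_card => e.
  by rewrite !inE -surjective_pairing andbC.
have -> : \sum_(r in B) #|nbrs2 R r| = #|[set e in R | e.2 \in B]|.
  transitivity (\sum_(r in B) \sum_(l | (l, r) \in R) 1).
    by apply: eq_bigr => l _; rewrite sum1dep_card.
  rewrite pair_big_dep /= sum1dep_card -card_transpose; apply: eq_card => e.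
  by rewrite !inE /= -surjective_pairing andbC.
apply: leq_trans (leq_card_setU _ _); apply/subset_leq_card/subsetP => e eR.
by rewrite !inE eR (forall_inP cR).
Qed.

(** With at most s - 1 cover vertices of degree at least h, the red edges would number at most (s -
    1)n + (h - s)(h - 1) < sn. *)
Lemma many_large_degrees R A B h s :
    covers R A B -> #|A| + #|B| < h -> h.-1 <= n -> 0 < s -> s <= h ->
    h.-1 * (h - s) < n -> s * n <= #|R| ->
  s <= #|[set l in A | h <= #|nbrs1 R l|]| + #|[set r in B | h <= #|nbrs2 R r|]|.
Proof.
move=> cR ltAB le_hn s_gt0 le_sh lt_n leR; rewrite leqNgt; apply/negP => lt_s.
have le_n (C : {set 'I_n}) : #|C| <= n by rewrite -[n in leqRHS]card_ord max_card.
have := card_covered_le cR.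
have := sum_le_threshold A h (fun l => le_n (nbrs1 R l)).
have := sum_le_threshold B h (fun r => le_n (nbrs2 R r)).
have leA : #|[set l in A | h <= #|nbrs1 R l|]| <= #|A|.
  by apply/subset_leq_card/subsetP=> x; rewrite inE => /andP[].
have leB : #|[set r in B | h <= #|nbrs2 R r|]| <= #|B|.
  by apply/subset_leq_card/subsetP=> x; rewrite inE => /andP[].
move: lt_s leA leB; set a := #|[set l in A | _]|; set b := #|[set r in B | _]|.
set dA := \sum_(l in A) _; set dB := \sum_(r in B) _.
move: ltAB leR lt_n le_hn s_gt0 le_sh.
move: #|A| #|B| #|R| a b dA dB => {cR le_n} cA cB cR a b dA dB.
move=> ltAB leR lt_n le_hn s_gt0 le_sh lt_s leA leB leB' leA' le_cR.
have: cR <= (a + b) * n + (cA - a + (cB - b)) * h.-1 by rewrite !mulnDl; lia.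
have: (cA - a + (cB - b)) * h.-1 <= (h.-1 - (a + b)) * h.-1.
  by rewrite leq_mul2r; apply/orP; right; lia.
(* The worst case is a + b = s - 1: making a cover vertex large replaces h - 1 by n in the bound. *)
have: (a + b) * n + (h.-1 - (a + b)) * h.-1 <= s.-1 * n + (h - s) * h.-1.
  have [d eq_d] : exists d, s.-1 = a + b + d by exists (s.-1 - (a + b)); lia.
  have -> : h.-1 - (a + b) = d + (h - s) by lia.
  rewrite eq_d !mulnDl addnA leq_add2r leq_add2l leq_mul2l.
  by rewrite le_hn orbT.
have: s * n = s.-1 * n + n by rewrite -{1}(prednK s_gt0) mulSn addnC.
by rewrite [_.-1 * (h - s)]mulnC in lt_n; lia.
Qed.

Lemma long_red_path_or_star R s eps h :
    h = 2 * s + 1 + eps -> eps <= 1 -> h < n -> h.-1 * (h - s) < n ->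
    s * n + eps <= #|R| ->
  [\/ long_red_path R h, star_shaped R s eps | star_shaped (transpose R) s eps].
Proof.
move=> def_h le_eps lt_hn lt_n leR.
have [/existsP[A /existsP[B /andP[cR ltAB]]]|noAB] :=
    boolP [exists A, exists B, covers R A B && (#|A| + #|B| < h)]; last first.
  have [|M [sMR [inj1 inj2] leM]] := @konig _ _ R h.
    move=> A B cR; rewrite leqNgt; apply: contra noAB => ltAB.
    by apply/existsP; exists A; apply/existsP; exists B; rewrite cR.
  have [N sNM eqN] := subset_of_card leM; constructor 1.
  have [||P [sP u1 u2 redP]] := @red_pairs_matching n R N.
  - exact: subset_trans sNM sMR.
  - by split=> e f /(subsetP sNM) eM /(subsetP sNM) fM; [apply: inj1 | apply: inj2].
  have [|P' [sP' u1' u2' redP']] := @red_pairs_pad n R P _ u1 u2; first by rewrite sP eqN.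
  by exists P'; split=> //; rewrite ?sP' ?sP -?eqN //; apply: leq_trans redP'.
set A' := [set l in A | h <= #|nbrs1 R l|]; set B' := [set r in B | h <= #|nbrs2 R r|].
have le_s : s <= #|A'| + #|B'|.
  have [->//|s_gt0] := posnP s.
  by apply: many_large_degrees => //; first [exact: leq_trans (leq_addr _ _) leR | lia].
pose SL := take s (enum A'); pose SR := take (s - size SL) (enum B').
have [uL uR] : uniq SL /\ uniq SR by rewrite !take_uniq ?enum_uniq.
have sLR : size SL + size SR = s.
  rewrite /SR /SL !size_take -!cardE; move: le_s; clear.
  by case: ltnP => ?; case: ltnP => ?; lia.
have dL l : l \in SL -> h <= #|nbrs1 R l|.
  by move/mem_take; rewrite mem_enum inE => /andP[].
have dR r : r \in SR -> h <= #|nbrs2 R r|.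
  by move/mem_take; rewrite mem_enum inE => /andP[].
set U := [set e in R | (e.1 \notin SL) && (e.2 \notin SR)].
(* If [U] is large, eps + 1 of its edges and the s stars fill eps + 1 + 2s = h pairs. *)
have [ltU|leU] := ltnP eps #|U|.
  constructor 1; have [|P [sP u1 u2 redP]] := red_pairs_few_edges le_eps _ uL uR ltU.
    by rewrite sLR; move: def_h lt_hn; clear; lia.
  apply: (long_red_path_of_stars lt_hn dL dR u1 u2) redP.
  by rewrite sP sLR; move: def_h; clear; lia.
pose A0 := [set l in SL]; pose B0 := [set r in SR].
have cA0 : #|A0| = size SL by rewrite cardsE (card_uniqP uL).
have cB0 : #|B0| = size SR by rewrite cardsE (card_uniqP uR).
pose W := setX A0 setT :|: setX setT B0.
have sRW : R :\: U \subset W.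
  apply/subsetP=> e; rewrite !inE andbT => /andP[]; rewrite andbC.
  by case: (e \in R); rewrite ?andbF // andbT negb_and !negbK.
have cW : #|W| + size SL * size SR = s * n.
  have -> : size SL * size SR = #|setX A0 setT :&: setX setT B0|.
    rewrite -cA0 -cB0 -cardsX; apply: eq_card => e; by rewrite !inE andbT.
  by rewrite cardsUI !cardsX cardsT card_ord cA0 cB0 [n * _]mulnC -mulnDl sLR.
have sUR : U \subset R by apply/subsetP=> e; rewrite inE => /andP[].
have cRU : #|R| = #|U| + #|R :\: U|.
  by rewrite -(cardsID U R) (setIidPr sUR).
have leRW : #|R :\: U| <= #|W| by apply: subset_leq_card.
(* The chain sn + eps <= |R| = |U| + |R - U| <= eps + |W| = eps + sn - |SL||SR| forces equality
   throughout. In particular all centers lie on one side. *)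
have [prod0 eqU eqRW] : [/\ size SL * size SR = 0, #|U| = eps & #|W| <= #|R :\: U|].
  by move: leU leR cW cRU leRW; clear; split; lia.
have defR : R = W :|: U.
  rewrite -(eqP (_ : R :\: U == W)); last by rewrite eqEcard sRW.
  by rewrite setUC -[LHS](setID R U) (setIidPr sUR).
have disjW : [disjoint U & W].
  apply/pred0P=> e; rewrite !inE /= andbT; apply/negbTE/negP.
  by move=> /andP[/andP[_ /andP[/negPf-> /negPf->]]].
move/eqP: prod0; rewrite muln_eq0 => /orP[]/nilP S0.
  have W0 : W = setX setT B0 by apply/setP=> e; rewrite !inE S0.
  constructor 3; exists B0, (transpose U); split.
  - by rewrite cB0 -sLR S0.
  - by rewrite card_transpose.
  - apply/pred0P=> e; have /pred0P/(_ (e.2, e.1)) := disjW.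
    by rewrite W0 !inE /= !andbT.
  by apply/setP=> e; rewrite inE defR W0 !inE /= !andbT.
have W0 : W = setX A0 setT by apply/setP=> e; rewrite !inE S0 /= orbF.
constructor 2; exists A0, U; rewrite -W0; split=> //.
by rewrite cA0 -sLR S0 addn0.
Qed.

End Dichotomy.

(** * Isomorphism up to isolated vertices *)

Lemma isomorphic_sym (G H : sgraph) : isomorphic G H -> isomorphic H G.
Proof.
by case=> f [g fK gK] adjf; exists g => [|x y]; [exists f | rewrite -adjf !gK].
Qed.

Lemma isomorphic_trans (G H K : sgraph) :
  isomorphic G H -> isomorphic H K -> isomorphic G K.
Proof.
case=> f bijf adjf [g bijg adjg]; exists (g \o f) => [|x y]; first exact: bij_comp.
by rewrite /= adjg adjf.
Qed.

Lemma iso0_refl (G : sgraph) : iso0 G G.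
Proof. by exists id => //; exists id. Qed.

(* The vertices outside the range of [f] are isolated. *)
Definition core_embedding (G H : sgraph) (f : G -> H) :=
  [/\ injective f, forall x y, adj (f x) (f y) = adj x y &
      forall x y, adj x y -> exists u, x = f u].

Lemma core_embedding_val (G : sgraph) : core_embedding (val : core G -> G).
Proof.
split=> [|//|x y xy]; first exact: val_inj.
have xP : [exists y, adj x y] by apply/existsP; exists y.
by exists (Sub x xP).
Qed.

Lemma core_embedding_iso (G H : sgraph) (f : G -> H) :
  bijective f -> (forall x y, adj (f x) (f y) = adj x y) -> core_embedding f.
Proof. by case=> g fK gK adjf; split=> [|//|x y _]; [exact: can_inj fK | exists (g x)]. Qed.

Lemma core_embedding_iso0 (G H : sgraph) (f : G -> H) : core_embedding f -> iso0 G H.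
Proof.
case=> injf adjf surf.
have fP (x : core G) : [exists y, adj (f (val x)) y].
  by case: x => x /= /existsP[y xy]; apply/existsP; exists (f y); rewrite adjf.
pose g (x : core G) : core H := Sub (f (val x)) (fP x).
exists g => [|x y]; last exact: adjf.
have injg : injective g by move=> x y /(congr1 val)/injf/val_inj.
apply: (inj_card_bij injg); apply: leq_trans (leq_image_card g _).
apply/subset_leq_card/subsetP=> -[x xP] _; have [y xy] := existsP xP.
have [u def_x] := surf _ _ xy; have [|v def_y] := surf y x; first by rewrite adj_sym.
have uP : [exists y, adj u y].
  by apply/existsP; exists v; rewrite -adjf -def_x -def_y.
by apply/imageP; exists (Sub u uP : core G) => //; apply: val_inj.
Qed.

Lemma num_edges_core_embedding (G H : sgraph) (f : G -> H) :
  core_embedding f -> num_edges G = num_edges H.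
Proof.
case=> injf adjf surf; rewrite /num_edges -(card_imset _ (imset_inj injf)).
apply: eq_card => e; apply/imsetP/imsetP => [[_ /imsetP[[u v] uv ->] ->]|[[x y] xy ->]].
  by exists (f u, f v); [move: uv; rewrite !inE /= adjf | rewrite /= imsetU !imset_set1].
rewrite inE /= in xy; have [u def_x] := surf _ _ xy.
have [|v def_y] := surf y x; first by rewrite adj_sym.
exists [set u; v]; last by rewrite imsetU !imset_set1 def_x def_y.
by apply/imsetP; exists (u, v); rewrite // inE -adjf -def_x -def_y.
Qed.

Lemma num_edges_iso0 (G H : sgraph) : iso0 G H -> num_edges G = num_edges H.
Proof.
case=> f bijf adjf; rewrite -(num_edges_core_embedding (core_embedding_val G)).
rewrite -(num_edges_core_embedding (core_embedding_val H)).
exact: num_edges_core_embedding (core_embedding_iso bijf adjf).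
Qed.

(** This invariant is all that excluding balanced copies requires of K_{s,n} and H_{s,n}. *)
Definition thin (G : sgraph) s eps := exists (C : {set G}) (D : {set {set G}}),
  [/\ #|C| <= s, #|D| <= eps &
      forall x y, adj x y -> [|| x \in C, y \in C | [set x; y] \in D]].

Lemma thin_induced (G H : sgraph) (f : G -> H) s eps :
  injective f -> (forall x y, adj (f x) (f y) = adj x y) -> thin H s eps -> thin G s eps.
Proof.
move=> injf adjf [C [D [leC leD cov]]].
exists (f @^-1: C), ((fun e : {set G} => f @: e) @^-1: D); split.
- rewrite -(card_imset _ injf); apply: leq_trans leC.
  by apply/subset_leq_card/subsetP=> _ /imsetP[x + ->]; rewrite inE.
- rewrite -(card_imset _ (imset_inj injf)); apply: leq_trans leD.
  by apply/subset_leq_card/subsetP=> _ /imsetP[x + ->]; rewrite inE.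
by move=> x y xy; rewrite !inE imsetU !imset_set1; apply: cov; rewrite adjf.
Qed.

Lemma thin_core (G : sgraph) s eps : thin (core G) s eps -> thin G s eps.
Proof.
case=> C [D [leC leD cov]]; have [_ _ surf] := core_embedding_val G.
exists (val @: C), [set val @: (e : {set core G}) | e in D]; split.
- exact: leq_trans (leq_imset_card _ _) leC.
- exact: leq_trans (leq_imset_card _ _) leD.
move=> x y xy; have [u def_x] := surf _ _ xy.
have [|v def_y] := surf y x; first by rewrite adj_sym.
have: adj u v by rewrite def_x def_y in xy.
move/cov; rewrite def_x def_y; case/or3P=> uvC.
- by rewrite imset_f.
- by rewrite (imset_f _ uvC) orbT.
by apply/or3P/Or33/imsetP; exists [set u; v]; rewrite ?imsetU ?imset_set1.
Qed.

(** The property descends to the core of [H], an induced subgraph, crosses the isomorphism, and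
    extends back from the core of [G]. *)
Lemma thin_iso0 (G H : sgraph) s eps : iso0 G H -> thin H s eps -> thin G s eps.
Proof.
case=> f bijf adjf thinH; apply/thin_core/(thin_induced (bij_inj bijf) adjf).
exact: (@thin_induced (core H) H val _ _ val_inj _ thinH).
Qed.

Lemma bip_edge_inj (S T : finType) :
  injective (fun e : S * T => [set inl e.1; inr e.2] : {set S + T}).
Proof.
move=> [a b] [c d] /= /setP eq_e; have := eq_e (inl a); have := eq_e (inr b).
by rewrite !inE !eqxx /= orbF => /esym/eqP[->] /esym/eqP[->].
Qed.

Lemma num_edges_bip m n (E : {set 'I_m * 'I_n}) : num_edges (bip_graph E) = #|E|.
Proof.
rewrite /num_edges -[RHS](card_imset _ (@bip_edge_inj _ _)); apply: eq_card => e.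
apply/imsetP/imsetP => [[[x y]]|[[a b] abE ->]]; last first.
  by exists (inl a, inr b); rewrite ?inE.
case: x y => [a|b] [a'|b'] //=; rewrite inE //= => abE ->; first by exists (a, b').
by exists (a', b); rewrite // setUC.
Qed.

(** Each vertex of [C] lies on at most two edges of a path, so a copy has at most 2s + eps = h - 1
    red edges and hence at least h + 1 blue ones. *)
Lemma thin_not_balanced n (R : {set 'I_n * 'I_n}) s eps h m :
    h = 2 * s + 1 + eps -> m = 2 * h \/ m = 2 * h + 1 -> thin (bip_graph R) s eps ->
  ~ has_balanced_copy (path_graph m) R.
Proof.
move=> def_h mh [C [D [leC leD cov]]] [f [embf _]].
rewrite copy_edges_pathC // => le2.
suff: #|copy_edges f :&: R| <= 2 * s + eps by case: mh => ?; lia.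
pose U := [set e : 'I_n * 'I_n | [set inl e.1; inr e.2] \in D].
pose W := [set e : 'I_n * 'I_n | (inl e.1 \in C) || (inr e.2 \in C)].
have leU : #|U| <= eps.
  apply: leq_trans leD; rewrite -(card_imset _ (@bip_edge_inj _ _)).
  by apply/subset_leq_card/subsetP=> _ /imsetP[e + ->]; rewrite inE.
suff leW : #|copy_edges f :&: W| <= 2 * s.
  apply: leq_trans (leq_add leW leU); apply: leq_trans (leq_card_setU _ _).
  apply/subset_leq_card/subsetP=> -[a b]; rewrite !inE => /andP[-> abR] /=.
  by have := cov (inl a) (inr b) abR; rewrite orbA.
(* Applied to the first and to the second ends of the edges, this gives the factor 2. *)
have count_C (g : 'I_m -> 'I_m.+1) : injective g -> \sum_(i < m) (f (g i) \in C) <= s.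
  move=> injg; rewrite (sum_bool_card (fun i => f (g i) \in C)).
  rewrite -(card_imset _ (inj_comp embf.1 injg)); apply: leq_trans leC.
  by apply/subset_leq_card/subsetP=> _ /imsetP[i + ->]; rewrite inE.
rewrite copy_edges_path // mul2n -addnn.
have inj_src : injective (widen_ord (leqnSn m)) by move=> i j [eq_ij]; apply: val_inj.
apply: leq_trans (leq_add (count_C _ inj_src) (count_C _ (@lift_inj _ ord0))).
rewrite -big_split; apply: leq_sum => i _ /=.
case: (f _) => [a|b]; case: (f _) => [a'|b'] //=; rewrite inE /=;
  by case: (_ \in C); case: (_ \in C).
Qed.

Lemma thin_complete_bip s n : thin (complete_bip s n) s 0.
Proof.
exists [set inl i | i : 'I_s], set0; split; rewrite ?cards0 //.
  by rewrite (leq_trans (leq_imset_card _ _)) // card_ord.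
by case=> [i|j] [i'|j'] //= _; rewrite imset_f ?orbT.
Qed.

Lemma thin_complete_bip_pendant s n : 0 < n -> thin (complete_bip_pendant s n) s 1.
Proof.
move=> n_gt0; pose j0 := Ordinal n_gt0.
exists [set inl i | i in [set~ (ord_max : 'I_s.+1)]], [set [set inl ord_max; inr j0]].
split; rewrite ?cards1 //.
  by rewrite (leq_trans (leq_imset_card _ _)) // cardsC1 card_ord.
have cov (i : 'I_s.+1) (j : 'I_n) : (i < s) || ((i == s :> nat) && (j == 0 :> nat)) ->
    i \in [set~ (ord_max : 'I_s.+1)] \/ (i = ord_max /\ j = j0).
  case/orP=> [lt_i|/andP[/eqP i_s /eqP j_0]]; [left | by right; split; apply: val_inj].
  by rewrite !inE -val_eqE /= neq_ltn lt_i.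
case=> [i|j] [i'|j'] //=; rewrite inE /= => /cov[iC|[-> ->]].
- by rewrite imset_f.
- by rewrite !inE eqxx !orbT.
- by rewrite (imset_f _ iC) orbT.
- by rewrite setUC !inE eqxx !orbT.
Qed.

Lemma num_edges_complete_bip s n : num_edges (complete_bip s n) = s * n.
Proof. by rewrite num_edges_bip cardsT card_prod !card_ord. Qed.

Lemma num_edges_complete_bip_pendant s n :
  0 < n -> num_edges (complete_bip_pendant s n) = s * n + 1.
Proof.
move=> n_gt0; pose j0 := Ordinal n_gt0; rewrite num_edges_bip.
have -> : [set e : 'I_s.+1 * 'I_n | (e.1 < s) || ((e.1 == s :> nat) && (e.2 == 0 :> nat))]
    = (ord_max, j0) |: setX [set~ ord_max] setT.
  apply/setP=> -[i j]; rewrite !inE /= andbT xpair_eqE -!val_eqE /=.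
  by have := ltn_ord i; rewrite orbC ltnS leq_eqVlt; case: ltngtP.
by rewrite cardsU1 cardsX cardsC1 cardsT !card_ord !inE /= eqxx addnC.
Qed.

Lemma iso0_star n (R : {set 'I_n * 'I_n}) s :
  star_shaped R s 0 -> iso0 (bip_graph R) (complete_bip s n).
Proof.
case=> A [U [cA /cards0_eq U0 _ defR]]; rewrite U0 setU0 in defR; case: _ / cA.
pose f (x : complete_bip #|A| n) : bip_graph R :=
  match x with inl i => inl (enum_val i) | inr j => inr j end.
apply/isomorphic_sym/(@core_embedding_iso0 _ _ f); split.
- by move=> [i|j] [i'|j'] //= []; [move/enum_val_inj-> | move->].
- by move=> [i|j] [i'|j'] //=; rewrite defR !inE andbT enum_valP.
move=> [a|b] y; last by exists (inr b).
case: y => //= b; rewrite defR !inE /= andbT => aA.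
by exists (inl (enum_rank_in aA a)); rewrite /= enum_rankK_in.
Qed.

Lemma iso0_star_pendant n (R : {set 'I_n * 'I_n}) s :
  star_shaped R s 1 -> iso0 (bip_graph R) (complete_bip_pendant s n).
Proof.
case=> A [U [cA /eqP/cards1P[[x0 y0] ->]]]; rewrite disjoints1 !inE andbT /=.
move=> x0A defR; case: _ / cA.
have n_gt0 : 0 < n by apply: leq_ltn_trans (ltn_ord y0).
pose j0 := Ordinal n_gt0.
pose fl (i : 'I_#|A|.+1) := if unlift ord_max i is Some i' then enum_val i' else x0.
have fl_inj : injective fl.
  move=> i i'; rewrite /fl; case: unliftP => [k|] ->; case: unliftP => [k'|] -> //.
  - by move/enum_val_inj->.
  - by move=> eq_x; rewrite -eq_x enum_valP in x0A.
  - by move=> eq_x; rewrite eq_x enum_valP in x0A.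
(* The transposition carries the right vertex 0 to the end [y0] of the extra edge; the complete part
   is unaffected by permuting the right side. *)
pose f (x : complete_bip_pendant #|A| n) : bip_graph R :=
  match x with inl i => inl (fl i) | inr j => inr (tperm j0 y0 j) end.
have adjf i j : ((fl i, tperm j0 y0 j) \in R) =
    ((i < #|A|) || ((i == #|A| :> nat) && (j == 0 :> nat))).
  rewrite defR !inE andbT xpair_eqE /fl; case: unliftP => [k|] ->.
    by rewrite enum_valP lift_max ltn_ord.
  rewrite /= ltnn eqxx (negPf x0A) eqxx /=.
  by rewrite -[X in _ == X](tpermL j0 y0) (inj_eq perm_inj).
apply/isomorphic_sym/(@core_embedding_iso0 _ _ f); split.
- move=> [i|j] [i'|j'] //= eq_f.
    by move: eq_f => [/fl_inj->].
  by move: eq_f => [/perm_inj->].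
- by move=> [i|j] [i'|j'] //=; rewrite adjf inE.
move=> [a|b] y; last by exists (inr (tperm j0 y0 b)); rewrite /= tpermK.
case: y => //= b; rewrite defR !inE /= andbT => /orP[aA|].
  exists (inl (lift ord_max (enum_rank_in aA a))); rewrite /= /fl liftK.
  by rewrite enum_rankK_in.
by rewrite xpair_eqE => /andP[/eqP-> _]; exists (inl ord_max); rewrite /= /fl unlift_none.
Qed.

Lemma iso0_transpose n (R : {set 'I_n * 'I_n}) :
  iso0 (bip_graph R) (bip_graph (transpose R)).
Proof.
pose f (x : bip_graph R) : bip_graph (transpose R) :=
  match x with inl a => inr a | inr b => inl b end.
apply: (@core_embedding_iso0 _ _ f); split.
- by move=> [a|b] [a'|b'] // [->].
- by move=> [a|b] [a'|b'] //=; rewrite inE.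
by move=> [a|b] _ _; [exists (inr a) | exists (inl b)].
Qed.

(** * Balancing numbers *)

Lemma card_setC_square n (R : {set 'I_n * 'I_n}) : #|R| + #|~: R| = n * n.
Proof. by rewrite cardsC card_prod !card_ord. Qed.

Lemma perm_enum_extension n (s : seq 'I_n) : uniq s ->
  exists t, perm_eq (enum 'I_n) (s ++ t).
Proof.
move=> us; exists [seq x <- enum 'I_n | x \notin s].
apply: uniq_perm (enum_uniq _) _ _ => [|x].
  rewrite cat_uniq us filter_uniq ?enum_uniq // andbT /=.
  by apply/hasPn=> x; rewrite mem_filter => /andP[].
by rewrite mem_cat [in RHS]mem_filter !mem_enum andbT orbN.
Qed.

(** Complete such a path to orderings of both sides. It has at most h + 1 edges in [R], but by
    [reds_gap] more than h, hence exactly h + 1, and a balanced copy results. *)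
Lemma no_long_red_path n h (x0 : 'I_n) (R : {set 'I_n * 'I_n}) m :
    0 < h -> h < n -> m = 2 * h \/ m = 2 * h + 1 -> ~ has_balanced_copy (path_graph m) R ->
    h < reds h x0 R (enum 'I_n) (enum 'I_n) ->
  ~ long_red_path (~: R) h.
Proof.
move=> h_gt0 lt_hn mh nobal gt_h [P [sP u1 u2 redP]].
have [X pX] := perm_enum_extension u1; have [Y pY] := perm_enum_extension u2.
have := reds_gap mh nobal lt_hn (perm_refl _) (perm_refl _) pX pY gt_h.
have [uX sX] : uniq (unzip1 P ++ X) /\ size (unzip1 P ++ X) = n.
  by rewrite -(perm_uniq pX) -(perm_size pX) enum_uniq size_enum_ord.
have [uY sY] : uniq (unzip2 P ++ Y) /\ size (unzip2 P ++ Y) = n.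
  by rewrite -(perm_uniq pY) -(perm_size pY) enum_uniq size_enum_ord.
have := redsC h x0 R (unzip1 P ++ X) (unzip2 P ++ Y); rewrite reds_red_pairs // => eq_red.
move=> gt_h'; apply: nobal; apply: (balanced_of_reds (x0 := x0) uX uY) mh.
- by rewrite sX.
- by rewrite sY.
(* Since h > 0, the truncated difference 2h + 1 - [reds] is positive, hence exact. *)
- by move: redP gt_h' h_gt0; rewrite eq_red; move: (reds _ _ _ _ _); clear; lia.
Qed.

(** On one path with 2h + 1 edges some color occurs more than h times; the other color then has no
    long path and must be star shaped. *)
Lemma star_of_no_balanced n s eps h m (R : {set 'I_n * 'I_n}) :
    h = 2 * s + 1 + eps -> eps <= 1 -> h < n -> h.-1 * (h - s) < n ->
    m = 2 * h \/ m = 2 * h + 1 -> ~ has_balanced_copy (path_graph m) R ->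
    s * n + eps <= #|R| -> s * n + eps <= #|~: R| ->
  exists2 Q, Q = R \/ Q = ~: R & star_shaped Q s eps \/ star_shaped (transpose Q) s eps.
Proof.
move=> def_h le_eps lt_hn lt_n mh nobal leR leR'.
have n_gt0 : 0 < n by apply: leq_ltn_trans lt_hn.
have h_gt0 : 0 < h by rewrite def_h addn1.
pose x0 := Ordinal n_gt0; pose X := enum 'I_n.
have [lt_h|le_h] := ltnP h (reds h x0 R X X).
  have noP := no_long_red_path h_gt0 lt_hn mh nobal lt_h.
  by case: (long_red_path_or_star def_h le_eps lt_hn lt_n leR') => // star;
    exists (~: R); auto.
have nobalC : ~ has_balanced_copy (path_graph m) (~: R) by move/has_balanced_copyC.
have lt_h : h < reds h x0 (~: R) X X.
  by rewrite redsC; move: le_h; move: (reds _ _ _ _ _); clear; lia.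
have := no_long_red_path h_gt0 lt_hn mh nobalC lt_h; rewrite setCK => noP.
by case: (long_red_path_or_star def_h le_eps lt_hn lt_n leR) => // star; exists R; auto.
Qed.

(** Only finitely many maps are to be tested once they are represented as finite functions. *)
Lemma has_balanced_copy_dec n (G : sgraph) (R : {set 'I_n * 'I_n}) :
  has_balanced_copy G R \/ ~ has_balanced_copy G R.
Proof.
pose balanced (f : {ffun G -> complete_bip n n}) :=
  [&& injectiveb f, [forall u, forall v, adj u v ==> adj (f u) (f v)],
      #|copy_edges f :&: R| <= #|copy_edges f :&: ~: R| + 1 &
      #|copy_edges f :&: ~: R| <= #|copy_edges f :&: R| + 1].
case: (boolP [exists f, balanced f]) => [/existsP[f /and4P[/injectiveP injf homf le1 le2]]|].
  left; exists f; split=> //; split=> // u v uv.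
  exact: implyP (forallP (forallP homf u) v) uv.
move=> /existsP noexf; right=> -[f [[injf homf] le1 le2]]; apply: noexf.
have eq_f : copy_edges (finfun f) = copy_edges f.
  apply/setP=> e; rewrite !inE; apply: eq_existsb => u; apply: eq_existsb => v.
  by rewrite !ffunE.
exists (finfun f); rewrite /balanced eq_f le1 le2 !andbT; apply/andP; split.
  by apply/injectiveP=> u v; rewrite !ffunE => /injf.
by apply/forallP=> u; apply/forallP=> v; rewrite !ffunE; apply/implyP/homf.
Qed.

(** A coloring with more than b edges of each color has no color class equivalent to [K], so b
    forces a balanced copy; [E0] shows that no smaller value does. *)
Lemma bbal_Bbal_singleton n (G K : sgraph) b :
    b < (n ^ 2) %/ 2 -> num_edges K = b ->
    (exists E : {set 'I_n * 'I_n}, iso0 (bip_graph E) K) ->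
    (forall R : {set 'I_n * 'I_n}, iso0 (bip_graph R) K -> ~ has_balanced_copy G R) ->
    (forall R : {set 'I_n * 'I_n}, b <= #|R| -> b <= #|~: R| ->
      ~ has_balanced_copy G R -> iso0 (bip_graph R) K \/ iso0 (bip_graph (~: R)) K) ->
  is_bbal n G b /\ Bbal_is_singleton n G K.
Proof.
move=> lt_b numK [E0 isoE0] nobalK isoK.
have card_iso R H : iso0 (@bip_graph n n R) H -> #|R| = num_edges H.
  by move/num_edges_iso0 <-; rewrite num_edges_bip.
(* Strictness ensures that the complement of a set of b edges has more than b edges, so it is never
   equivalent to a graph with b edges. *)
have lt_2b : 2 * b < n * n by move: lt_b; rewrite -mulnn; lia.
have nobalC (R : {set 'I_n * 'I_n}) : iso0 (bip_graph (~: R)) K -> ~ has_balanced_copy G R.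
  by move=> isoR balR; case: (nobalK _ isoR); apply: has_balanced_copyC; rewrite setCK.
have bbalb : is_bbal n G b.
  split=> // [R ltR ltR'|k lt_k forces_k].
    case: (has_balanced_copy_dec G R) => // nobal.
    by case: (isoK R (ltnW ltR) (ltnW ltR') nobal) => /card_iso; rewrite numK; lia.
  rewrite leqNgt; apply/negP=> lt_kb; case: (nobalK _ isoE0).
  have cardE0 : #|E0| = b by rewrite (card_iso _ _ isoE0).
  by apply: forces_k; have := card_setC_square E0; lia.
split=> // F; split=> [[b' bbalb' [closedF edgesF occursF nobalF]] H'|defF].
  have eq_b : b' = b.
    case: bbalb bbalb' => lt1 f1 min1 [lt2 f2 min2].
    by apply/eqP; rewrite eqn_leq min1 ?min2.
  rewrite {}eq_b {bbalb'} in edgesF nobalF; split=> [FH'|isoH'].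
    have [E isoE] := occursF _ FH'.
    have cardE : #|E| = b by rewrite (card_iso _ _ isoE) edgesF.
    have cardE' : #|~: E| = n * n - b by have := card_setC_square E; lia.
    have [leE leE'] : b <= #|E| /\ b <= #|~: E| by split; lia.
    have nobalE : ~ has_balanced_copy G E.
      by apply/(nobalF E leE leE'); [left | exists H'; [|left]].
    case: (isoK E leE leE' nobalE) => [isoEK|/card_iso]; last by rewrite numK; lia.
    exact: isomorphic_trans (isomorphic_sym isoE) isoEK.
  have cardE0 : #|E0| = b by rewrite (card_iso _ _ isoE0).
  have cardE0' : #|~: E0| = n * n - b by have := card_setC_square E0; lia.
  have [leE0 leE0'] : b <= #|E0| /\ b <= #|~: E0| by split; lia.
  have /(nobalF E0 leE0 leE0' (or_introl cardE0)) := nobalK _ isoE0.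
  case=> H FH [isoH|/card_iso]; last by rewrite (edgesF _ FH); lia.
  apply: closedF FH; apply: isomorphic_trans (isomorphic_sym isoH) _.
  exact: isomorphic_trans isoE0 (isomorphic_sym isoH').
exists b => //; split=> [H H' isoH /defF isoHK|H /defF/num_edges_iso0-> //|H /defF isoH|].
- by apply/defF; apply: isomorphic_trans (isomorphic_sym isoH) isoHK.
- by exists E0; apply: isomorphic_trans isoE0 (isomorphic_sym isoH).
move=> R leR leR' _; split=> [nobal|[H /defF isoH []isoR]].
- by exists K; [apply/defF/iso0_refl | apply: isoK].
- by apply: nobalK; apply: isomorphic_trans isoR isoH.
by apply: nobalC; apply: isomorphic_trans isoR isoH.
Qed.

Lemma bbal_path n s eps h m K :
    h = 2 * s + 1 + eps -> eps <= 1 -> h < n -> h.-1 * (h - s) < n ->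
    m = 2 * h \/ m = 2 * h + 1 -> num_edges K = s * n + eps -> thin K s eps ->
    (forall R : {set 'I_n * 'I_n}, star_shaped R s eps -> iso0 (bip_graph R) K) ->
  is_bbal n (path_graph m) (s * n + eps) /\ Bbal_is_singleton n (path_graph m) K.
Proof.
move=> def_h le_eps lt_hn lt_n mh numK thinK star_iso.
have lt_sn : 2 * s + 2 <= n by lia.
(* The slack 2n >= 4 absorbs 2 eps + 2, which puts b below the floor of n^2 / 2. *)
have le_nn : 2 * (s * n) + 2 * n <= n * n by rewrite mulnA -mulnDl leq_mul2r lt_sn orbT.
have lt_b : s * n + eps < (n ^ 2) %/ 2.
  by rewrite -mulnn leq_divRL //; move: le_nn lt_sn le_eps; clear; lia.
have [|A _ cA] := @subset_of_card _ [set: 'I_n] s; first by rewrite cardsT card_ord; lia.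
have cAn : #|setX A [set: 'I_n]| = s * n by rewrite cardsX cA cardsT card_ord.
have [|U sU cU] := @subset_of_card _ (~: setX A [set: 'I_n]) eps.
  rewrite cardsCs setCK card_prod !card_ord cAn.
  by move: le_nn lt_sn le_eps; clear; lia.
apply: bbal_Bbal_singleton => //.
- exists (setX A setT :|: U); apply: star_iso; exists A, U; split=> //.
  by rewrite disjoints_subset.
- move=> R isoR; exact: (thin_not_balanced def_h mh (thin_iso0 isoR thinK)).
move=> R leR leR' nobal.
have isoQ Q : star_shaped Q s eps \/ star_shaped (transpose Q) s eps ->
    iso0 (@bip_graph n n Q) K.
  case=> /star_iso // isoQT; exact: isomorphic_trans (iso0_transpose Q) isoQT.
have [Q [] -> star] := star_of_no_balanced def_h le_eps lt_hn lt_n mh nobal leR leR'.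
  by left; apply: isoQ.
by right; apply: isoQ.
Qed.

Theorem theorem12 (n k alpha : nat) :
  2 <= n -> 2 <= k -> ~~ odd k ->
  alpha = 0 \/ alpha = 2 -> k = alpha %[mod 4] ->
  (k - 2) %/ 2 * (k %/ 2 - (k - 2) %/ 4) < n ->
  let s := (k - 2) %/ 4 in
  [/\ is_bbal n (path_graph k) (s * n + 0 ^ alpha),
      is_bbal n (path_graph k.+1) (s * n + 0 ^ alpha),
      k = 2 %[mod 4] ->
        Bbal_is_singleton n (path_graph k) (complete_bip s n) /\
        Bbal_is_singleton n (path_graph k.+1) (complete_bip s n) &
      k = 0 %[mod 4] ->
        Bbal_is_singleton n (path_graph k) (complete_bip_pendant s n) /\
        Bbal_is_singleton n (path_graph k.+1) (complete_bip_pendant s n)].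
Proof.
move=> n_ge2 k_ge2 even_k alphaE k_mod lt_n s.
have n_gt0 : 0 < n by apply: leq_trans n_ge2.
have [h def_k] : exists h, k = 2 * h by exists k./2; move: even_k; clear; lia.
have k2_half : (k - 2) %/ 2 = h.-1 by rewrite def_k -[X in _ - X]muln1 -mulnBr mulKn // subn1.
have k_half : k %/ 2 = h by rewrite def_k mulKn.
have {}lt_n : h.-1 * (h - s) < n.
  by rewrite -k2_half -k_half.
have bbalP eps K : h = 2 * s + 1 + eps -> eps <= 1 -> num_edges K = s * n + eps ->
    thin K s eps ->
    (forall R : {set 'I_n * 'I_n}, star_shaped R s eps -> iso0 (bip_graph R) K) ->
  (is_bbal n (path_graph k) (s * n + eps) /\ Bbal_is_singleton n (path_graph k) K) /\
  (is_bbal n (path_graph k.+1) (s * n + eps) /\ Bbal_is_singleton n (path_graph k.+1) K).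
  move=> def_h le_eps numK thinK star_iso.
  (* For s = 0 this is [2 <= n] or [lt_n] itself, according to [eps]; for s > 0, h <= 2(h - 1) <= (h
     - 1)(h - s). *)
  have lt_hn : h < n.
    have [s0|s_gt0] := posnP s.
      move: lt_n; rewrite def_h s0.
      by case: eps le_eps {def_h numK thinK star_iso} => [|[|//]].
    apply: leq_ltn_trans lt_n; apply: leq_trans (_ : h.-1 * 2 <= _).
      by move: def_h s_gt0; clear; lia.
    by rewrite leq_mul2l; apply/orP; right; move: def_h s_gt0; clear; lia.
  by split; apply: (bbal_path def_h le_eps lt_hn lt_n) => //; move: def_k; clear; lia.
(* Here [0 ^ alpha] computes to [eps], namely 1 for alpha = 0 and 0 for alpha = 2, and one of the
   two congruences in the conclusion becomes absurd. *)
case: alphaE => alpha_eq; rewrite alpha_eq in k_mod *.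
  have def_h : h = 2 * s + 1 + 1 by move: k_ge2 k_mod def_k; rewrite /s; clear; lia.
  have [] := bbalP _ _ def_h isT (num_edges_complete_bip_pendant s n_gt0)
    (thin_complete_bip_pendant s n_gt0) (@iso0_star_pendant n ^~ s).
  by move=> [bbal1 Bbal1] [bbal2 Bbal2]; split=> //; rewrite k_mod.
have def_h : h = 2 * s + 1 + 0 by move: k_ge2 k_mod def_k; rewrite /s; clear; lia.
have [] := bbalP _ (complete_bip s n) def_h isT _ (thin_complete_bip s n) (@iso0_star n ^~ s).
  by rewrite addn0 num_edges_complete_bip.
by move=> [bbal1 Bbal1] [bbal2 Bbal2]; split=> //; rewrite k_mod.
Qed.
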